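(* Let $\mu>0$, $\gamma\ge3$, $t_0>0$, and $\kappa:=\frac{1}{\gamma-1}\in(0,1/2]$. Define $$\theta(t)=\frac{1}{\sqrt\mu}\tanh\left(\kappa\sqrt\mu\,t\right),\qquad t\ge t_0 .$$ Then $\theta:[t_0,+\infty)\to(0,+\infty)$ is continuously differentiable, nondecreasing, and satisfies $0<2\dot\theta(t)+\mu\theta(t)^2\le1$ for all $t\ge t_0$, and the corresponding damping coefficient $\delta_\mu(t)=\frac{1+\dot\theta(t)}{\theta(t)}+\mu\theta(t)$ is $$\delta_\mu(t)=\sqrt\mu\left[(1+\kappa)\coth\left(\kappa\sqrt\mu\,t\right)+(1-\kappa)\tanh\left(\kappa\sqrt\mu\,t\right)\right].$$ For every fixed $t>0$, $\delta_\mu(t)\to\frac{\gamma}{t}$ as $\mu\downarrow0$, whereas, for every fixed $\mu>0$, $\delta_\mu(t)\to2\sqrt\mu$ as $t\to+\infty$. Moreover, let $\mathcal H$ be a real Hilbert space and let $\Phi:\mathcal H\to\mathbb R$ be continuously Fréchet differentiable and $\mu$-strongly convex with $\operatorname{argmin}\Phi\ne\varnothing$, $x^*\in\operatorname{argmin}\Phi$, $\Phi^*=\Phi(x^* )$. Then every global solution $x\in C^2([t_0,+\infty),\mathcal H)$ of $$\ddot x(t)+\delta_\mu(t)\dot x(t)+\nabla\Phi(x(t))=0,\qquad t\ge t_0,$$ satisfies, for every $t\ge t_0$, $$\Phi(x(t))-\Phi^*\le\mathcal E(t_0)\min\left\{\frac{\cosh^{\gamma-1}(\kappa\sqrt\mu\,t_0)}{\kappa^2t^2},\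 \frac{2^{\gamma-1}\mu\cosh^{\gamma-1}(\kappa\sqrt\mu\,t_0)}{\left(1-e^{-2\kappa\sqrt\mu\,t_0}\right)^2}\,e^{-\sqrt\mu\,t}\right\}.$$ In particular, $\Phi(x(t))-\Phi^*=\mathcal O\left(\min\left\{\frac1{t^2},e^{-\sqrt\mu t}\right\}\right)$.
   Context: A differentiable function $\Phi$ on $\mathcal H$ is $\mu$-strongly convex if $\Phi(y)\ge\Phi(x)+\langle\nabla\Phi(x),y-x\rangle+\frac{\mu}{2}\|y-x\|^2$ for all $x,y\in\mathcal H$. The quantity $\mathcal E(t_0)$ is the value at $t=t_0$ of $$\mathcal E(t)=A(t)\bigl(\Phi(x(t))-\Phi^*\bigr)+\frac{A(t)}{2\theta(t)^2}\left\|x(t)-x^*+\theta(t)\dot x(t)\right\|^2,\qquad A(t)=\theta(t)^2\exp\left(\int_{t_0}^t\mu\theta(s)\,ds\right),$$ so $A(t_0)=\theta(t_0)^2$. *)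

(* Defs.v *)
From Stdlib Require Export Reals.
From Coquelicot Require Export Coquelicot.

Open Scope R_scope.

(* [inner_self] gives positivity and definiteness of [inner], and says that the
   norm for which the space is complete is the one induced by [inner]. *)
Record HilbertSpace := {
  hilbert_carrier :> CompleteNormedModule R_AbsRing;
  inner : hilbert_carrier -> hilbert_carrier -> R;
  inner_sym : forall u v, inner u v = inner v u;
  inner_plus_l : forall u v w, inner (plus u v) w = inner u w + inner v w;
  inner_scal_l : forall (a : R) u v, inner (scal a u) v = a * inner u v;
  inner_self : forall u, inner u u = norm u ^ 2
}.

Arguments inner {_} _ _.

Definition coth (u : R) : R := cosh u / sinh u.

(* [f'] is the derivative of [f] on [t0, +oo), one-sided at [t0], and it is
   continuous there; the values of [f] and [f'] before [t0] are irrelevant. *)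
Definition C1_on {V : NormedModule R_AbsRing} (t0 : R) (f f' : R -> V) : Prop :=
  (forall t, t0 <= t ->
     filterdiff f (within (Rle t0) (locally t)) (fun h : R => scal h (f' t))) /\
  continuous_on (Rle t0) f'.

Definition C2_on {V : NormedModule R_AbsRing} (t0 : R) (f f' f'' : R -> V) : Prop :=
  C1_on t0 f f' /\ C1_on t0 f' f''.

Section Objective.

Context {H : HilbertSpace}.

(* Continuous Frechet differentiability of [Phi], with [g] its gradient, i.e.
   the Riesz representative of the Frechet derivative. *)
Definition C1_gradient (Phi : H -> R) (g : H -> H) : Prop :=
  (forall x : H, filterdiff Phi (locally x) (fun h : H => inner (g x) h)) /\
  (forall x : H, continuous g x).

Definition strongly_convex (mu : R) (Phi : H -> R) (g : H -> H) : Prop :=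
  forall x y : H,
    Phi y >= Phi x + inner (g x) (minus y x) + mu / 2 * norm (minus y x) ^ 2.

Definition argmin (Phi : H -> R) (z : H) : Prop := forall y : H, Phi z <= Phi y.

End Objective.

Definition theta (mu kappa t : R) : R := / sqrt mu * tanh (kappa * sqrt mu * t).

Definition damping (mu : R) (th : R -> R) (t : R) : R :=
  (1 + Derive th t) / th t + mu * th t.

Definition delta (mu kappa t : R) : R := damping mu (theta mu kappa) t.

Definition solution {H : HilbertSpace} (t0 : R) (d : R -> R) (g : H -> H)
    (x x' x'' : R -> H) : Prop :=
  C2_on t0 x x' x'' /\
  forall t, t0 <= t -> plus (plus (x'' t) (scal (d t) (x' t))) (g (x t)) = zero.

Definition weight (mu : R) (th : R -> R) (t0 t : R) : R :=
  th t ^ 2 * exp (RInt (fun s => mu * th s) t0 t).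

Definition energy {H : HilbertSpace} (mu : R) (th : R -> R) (t0 : R)
    (Phi : H -> R) (xs : H) (x x' : R -> H) (t : R) : R :=
  weight mu th t0 t * (Phi (x t) - Phi xs) +
  weight mu th t0 t / (2 * th t ^ 2) *
    norm (plus (minus (x t) xs) (scal (th t) (x' t))) ^ 2.

Definition bigO_infty (f h : R -> R) : Prop :=
  exists C : R, Rbar_locally p_infty (fun t => Rabs (f t) <= C * Rabs (h t)).

(* Main.v *)
Require Import Defs.
From Stdlib Require Import Reals Lra Psatz.
From Coquelicot Require Import Coquelicot.

Open Scope R_scope.

(** The bound is a Lyapunov argument. Put f = Phi(x) - Phi*, w = x - x*,
    v = w + theta x' and B(t) = exp (int_t0^t mu theta), so that the energy is
    E = B (theta^2 f + |v|^2 / 2). The damping is chosen exactly so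
    that v' = - mu theta^2 x' - theta grad Phi(x): no other velocity term is
    left. Strong convexity between x and x* bounds <grad Phi(x), w> from
    below by f + mu/2 |w|^2, and this leaves
    E' <= B theta (2 theta' + mu theta^2 - 1) f - B (mu/2) theta^3 |x'|^2,
    which is nonpositive as soon as 2 theta' + mu theta^2 <= 1. This holds for
    any positive such theta ([energy_nonincreasing]); hence
    f <= E(t0) / A(t) with A = theta^2 B.

    For theta = tanh u / sqrt mu with u = kappa sqrt mu t, one has
    2 theta' + mu theta^2 = 2 kappa + (1 - 2 kappa) tanh^2 u, which is at most 1
    because kappa <= 1/2, and the integral is elementary:
    B = (cosh u / cosh u0)^(gamma - 1) ([weight_theta]). The two rates are then two
    lower bounds for tanh^2 u cosh^(gamma - 1) u = sinh^2 u cosh^(gamma - 3) u.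
    From cosh >= 1 and sinh u >= u it is at least u^2 ([growth_ge_sqr]); from
    cosh u >= e^u / 2 and sinh u = (1 - e^(-2u)) e^u / 2 it is at least
    (1 - e^(-2 u0))^2 (e^u / 2)^(gamma - 1) ([growth_ge_exp]), where
    e^((gamma - 1) u) = e^(sqrt mu t) as kappa (gamma - 1) = 1.

    The limits of the damping coefficient come from 1 <= u coth u <= cosh u when
    mu vanishes, and from writing it as a continuous function of e^(-2u) when t
    goes to infinity. *)

(** * Inner products and the derivative of the squared norm *)

Section InnerProduct.

Context {H : HilbertSpace}.
Implicit Types u v w : H.

Lemma inner_plus_r u v w : inner u (plus v w) = inner u v + inner u w.
Proof. now rewrite inner_sym, inner_plus_l, !(inner_sym _ _ u). Qed.

Lemma inner_scal_r (a : R) u v : inner u (scal a v) = a * inner u v.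
Proof. now rewrite inner_sym, inner_scal_l, inner_sym. Qed.

Lemma inner_opp_l u v : inner (opp u) v = - inner u v.
Proof.
  replace (opp u) with (scal (opp (one : R_AbsRing)) u) by apply (scal_opp_one u).
  change (opp (one : R_AbsRing)) with (-1). rewrite inner_scal_l. ring.
Qed.

Lemma inner_opp_r u v : inner u (opp v) = - inner u v.
Proof. now rewrite inner_sym, inner_opp_l, inner_sym. Qed.

Lemma inner_zero_l v : inner zero v = 0.
Proof.
  assert (E := inner_plus_l H zero zero v). rewrite plus_zero_l in E. lra.
Qed.

(** Expanding |u + v|^2 turns the triangle inequality of the norm, which is part
    of the normed structure, into the bound on the inner product. *)
Lemma cauchy_schwarz u v : Rabs (inner u v) <= norm u * norm v.
Proof.
  assert (half : forall a b : H, inner a b <= norm a * norm b).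
  { intros a b.
    assert (E := inner_self H (plus a b)).
    rewrite inner_plus_l, !inner_plus_r, !inner_self, (inner_sym _ b a) in E.
    assert (T : norm (plus a b) <= norm a + norm b)
      by exact (norm_triangle (K := R_AbsRing) a b).
    assert (P : 0 <= norm (plus a b)) by exact (norm_ge_0 (K := R_AbsRing) (plus a b)).
    nra. }
  apply Rabs_le; split; [|apply half].
  assert (P : norm (opp u) = norm u) by apply (norm_opp u).
  generalize (half (opp u) v). rewrite inner_opp_l, P. lra.
Qed.

Lemma is_linear_inner u : is_linear (fun h : H => inner u h : R_NormedModule).
Proof.
  split.
  - intros; apply inner_plus_r.
  - intros; apply inner_scal_r.
  - exists (norm u + 1). split.
    + assert (P : 0 <= norm u) by exact (norm_ge_0 (K := R_AbsRing) u). lra.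
    + intros h. eapply Rle_trans; [apply cauchy_schwarz|].
      assert (P : 0 <= norm h) by exact (norm_ge_0 (K := R_AbsRing) h). nra.
Qed.

(** The remainder of the expansion of the inner square at [v] is the inner
    square of the increment, hence is of second order. *)
Lemma filterdiff_inner_self v :
  filterdiff (fun w : H => inner w w : R_NormedModule) (locally v)
    (fun h : H => 2 * inner v h).
Proof.
  split.
  - assert (L := is_linear_inner (scal 2 v)).
    assert (E : forall h : H, inner (scal 2 v) h = 2 * inner v h)
      by (intros; apply inner_scal_l).
    destruct L as [L1 L2 [M [M0 L3]]]. split.
    + intros; rewrite <- !E; apply L1.
    + intros; rewrite <- !E; apply L2.
    + exists M; split; auto. intros; rewrite <- E; apply L3.
  - intros x Hx. rewrite <- (is_filter_lim_locally_unique _ _ Hx). clear x Hx.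
    intros eps.
    apply (filter_imp (fun w : H => norm (minus w v) < eps)).
    + intros w Hw.
      assert (E : minus (minus (inner w w) (inner v v)) (2 * inner v (minus w v))
                  = norm (minus w v) ^ 2).
      { rewrite <- inner_self. unfold minus at 1 2.
        change (inner w w + - inner v v + - (2 * inner v (minus w v))
                = inner (minus w v) (minus w v)).
        unfold minus.
        rewrite !inner_plus_l, !inner_plus_r, !inner_opp_l, !inner_opp_r,
          (inner_sym _ w v). ring. }
      change (Rabs (minus (minus (inner w w) (inner v v)) (2 * inner v (minus w v)))
              <= eps * norm (minus w v)).
      rewrite E.
      assert (P : 0 <= norm (minus w v)) by exact (norm_ge_0 (K := R_AbsRing) (minus w v)).
      rewrite Rabs_pos_eq by apply pow2_ge_0.
      nra.
    + apply (locally_le_locally_norm (K := R_AbsRing) (V := H)).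
      exists eps. intros w Hw. exact Hw.
Qed.

End InnerProduct.

(** * Calculus on a closed half-line *)

Lemma is_derive_comp_filterdiff {H : HilbertSpace} (F : H -> R) (l : H -> R)
    (x : R -> H) (x' : H) (t : R) :
  filterdiff (F : H -> R_NormedModule) (locally (x t)) l ->
  is_derive x t x' -> is_derive (fun s => F (x s)) t (l x').
Proof.
  intros HF Hx. unfold is_derive.
  apply (filterdiff_ext_lin _ (fun h : R => l (scal h x'))).
  - apply (filterdiff_comp' x F t (fun h => scal h x') l Hx HF).
  - intros h. apply (linear_scal _ (proj1 HF)).
Qed.

Lemma within_filter_lim (t0 t : R) : is_filter_lim (within (Rle t0) (locally t)) t.
Proof. intros P HP. unfold within. now apply filter_imp with (2 := HP). Qed.

Lemma is_derive_of_within {V : NormedModule R_AbsRing} (t0 t : R) (f : R -> V) (l : V) :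
  t0 < t ->
  filterdiff f (within (Rle t0) (locally t)) (fun h : R => scal h l) ->
  is_derive f t l.
Proof.
  intros Ht [L D]. split; [exact L|].
  intros y Hy eps. rewrite <- (is_filter_lim_locally_unique _ _ Hy).
  specialize (D t (within_filter_lim t0 t) eps). unfold within in D.
  apply (fun h => filter_imp _ _ h (filter_and _ _ (open_gt t0 t Ht) D)).
  intros s [Hs Ds]. apply Ds. now apply Rlt_le.
Qed.

(** Freezing a function before [t0] turns its one-sided continuity at [t0]
    into two-sided continuity, the form that the mean value theorem takes. *)
Lemma continuous_clamp {V : UniformSpace} (t0 t : R) (f : R -> V) :
  t0 <= t ->
  filterlim f (within (Rle t0) (locally t)) (locally (f t)) ->
  continuous (fun s => f (Rmax t0 s)) t.
Proof.
  intros Ht Hf. unfold continuous. rewrite (Rmax_right t0 t Ht).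
  refine (filterlim_comp _ _ _ (Rmax t0) f _ _ _ _ Hf).
  intros P [eps HP]. exists eps. intros s Hs.
  apply HP; [|apply Rmax_l].
  unfold ball in *; simpl in *; unfold AbsRing_ball, abs, minus, plus, opp in *; simpl in *.
  eapply Rle_lt_trans; [|exact Hs].
  unfold Rmax; destruct (Rle_dec t0 s); unfold Rabs; repeat destruct Rcase_abs; lra.
Qed.

Lemma filterlim_of_filterdiff_within {V : NormedModule R_AbsRing} (t0 t : R)
    (f : R -> V) (l : R -> V) :
  filterdiff f (within (Rle t0) (locally t)) l ->
  filterlim f (within (Rle t0) (locally t)) (locally (f t)).
Proof.
  intros D. apply filterdiff_continuous_aux.
  - now exists l.
  - apply within_filter_lim.
Qed.

Lemma C1_on_of_derive {V : NormedModule R_AbsRing} (t0 : R) (f f' : R -> V) :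
  (forall t, t0 <= t -> is_derive f t (f' t)) ->
  (forall t, t0 <= t -> continuous f' t) -> C1_on t0 f f'.
Proof.
  intros D C. split; [|now apply continuous_on_forall].
  intros t Ht.
  refine (@filterdiff_locally _ _ _ (within (Rle t0) (locally t)) _ f t _ _ (D t Ht)).
  - split; [|apply within_filter, locally_filter].
    intros P HP. exists t. exact (locally_singleton _ _ HP Ht).
  - apply within_filter_lim.
Qed.

Lemma nonincreasing_of_derive_nonpos (f f' : R -> R) (a b : R) :
  a <= b ->
  (forall t, a <= t -> continuous (fun s => f (Rmax a s)) t) ->
  (forall t, a < t -> is_derive f t (f' t)) ->
  (forall t, a < t -> f' t <= 0) ->
  f b <= f a.
Proof.
  intros Hab C D N.
  (* The mean value point may be the endpoint [a], where [f' a] says nothing: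
     truncating the derivative at 0 makes the sign available there too. *)
  destruct (MVT_gen (fun s => f (Rmax a s)) a b (fun s => Rmin (f' s) 0)) as [c [Hc E]].
  - rewrite Rmin_left, Rmax_right by easy. intros t Ht.
    rewrite Rmin_left by (apply N; lra).
    apply (is_derive_ext_loc f); [|apply D; lra].
    apply (fun h => filter_imp _ _ h (open_gt a t (proj1 Ht))).
    intros s Hs. rewrite Rmax_right; [easy|lra].
  - rewrite Rmin_left, Rmax_right by easy. intros t Ht.
    apply continuity_pt_filterlim, C, Ht.
  - rewrite (Rmax_right a b), (Rmax_left a a) in E by lra.
    assert (Rmin (f' c) 0 <= 0) by apply Rmin_r. nra.
Qed.

(** * Monotonicity of the energy *)

Lemma is_derive_energy_form (b a p q : R -> R) (c b' a' p' q' t : R) :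
  is_derive b t b' -> is_derive a t a' -> is_derive p t p' -> is_derive q t (2 * q') ->
  is_derive (fun s => b s * (a s ^ 2 * (p s - c) + q s / 2)) t
    (b' * (a t ^ 2 * (p t - c) + q t / 2) +
     b t * (2 * a t * a' * (p t - c) + a t ^ 2 * p' + q')).
Proof.
  intros Db Da Dp Dq. auto_derive.
  - repeat split; eexists; eassumption.
  - replace (Derive (fun s => b s) t) with b' by (symmetry; exact (is_derive_unique b t b' Db)).
    replace (Derive (fun s => a s) t) with a' by (symmetry; exact (is_derive_unique a t a' Da)).
    replace (Derive (fun s => p s) t) with p' by (symmetry; exact (is_derive_unique p t p' Dp)).
    replace (Derive (fun s => q s) t) with (2 * q')
      by (symmetry; exact (is_derive_unique q t _ Dq)).
    field.
Qed.

(** The algebra behind the decay of the energy. With w = x - x*, p = x' and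
    gr = grad Phi(x), the reals stand for f = Phi(x) - Phi*, pp = <p, p>,
    ww = <w, w>, gw = <gr, w>, gp = <gr, p>, wp = <w, p>, with a = theta,
    da = theta', d the damping and b the exponential factor. Strong convexity
    enters as the bound on gw, and x'' has been eliminated by the equation. *)
Lemma energy_derivative_nonpos (mu f pp ww gw gp wp : R) (a da d b : R) :
  0 <= mu -> 0 < a -> 0 <= b -> 0 <= f -> 0 <= pp ->
  2 * da + mu * a ^ 2 <= 1 ->
  f + mu / 2 * ww <= gw ->
  d = (1 + da) / a + mu * a ->
  let vp := wp + a * pp in
  let vg := gw + a * gp in
  let vv := ww + 2 * a * wp + a ^ 2 * pp in
  mu * a * b * (a ^ 2 * f + vv / 2) +
  b * (2 * a * da * f + a ^ 2 * gp + (vp + (da * vp + a * (- (d * vp + vg))))) <= 0.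
Proof.
  intros hmu ha hB hf hpp hth hsc -> vp vg vv. unfold vp, vg, vv.
  (* a sum of three nonpositive terms: growth condition, strong convexity,
     kinetic energy *)
  match goal with |- ?e <= 0 =>
    replace e with (b * a * ((2 * da + mu * a ^ 2 - 1) * f + (f + mu / 2 * ww - gw)
                             - mu / 2 * (a ^ 2 * pp))) by (field; lra) end.
  assert (0 <= b * a) by nra.
  assert (0 <= a ^ 2 * pp) by (apply Rmult_le_pos; [apply pow2_ge_0|easy]).
  assert ((2 * da + mu * a ^ 2 - 1) * f <= 0) by nra.
  assert (0 <= mu / 2 * (a ^ 2 * pp)) by nra.
  nra.
Qed.

Section Lyapunov.

Context {H : HilbertSpace} (mu t0 : R) (th : R -> R).
Context (Phi : H -> R) (g : H -> H) (xs : H) (x x' x'' : R -> H).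

Let w t : H := minus (x t) xs.
Let v t : H := plus (w t) (scal (th t) (x' t)).
Let B t := exp (RInt (fun s => mu * th s) t0 t).
Let F t := B t * (th t ^ 2 * (Phi (x t) - Phi xs) + inner (v t) (v t) / 2).

Lemma energy_factored t : th t <> 0 -> energy mu th t0 Phi xs x x' t = F t.
Proof.
  intros Ht. unfold F. rewrite inner_self.
  change (th t ^ 2 * B t * (Phi (x t) - Phi xs)
          + th t ^ 2 * B t / (2 * th t ^ 2) * norm (v t) ^ 2
          = B t * (th t ^ 2 * (Phi (x t) - Phi xs) + norm (v t) ^ 2 / 2)).
  field. exact Ht.
Qed.

(** Differentiability of [th] on the whole line, rather than after [t0] only,
    makes this derivative two-sided at [t0] as well. *)
Lemma is_derive_exp_RInt : (forall t, ex_derive th t) ->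
  forall t, is_derive B t (mu * th t * B t).
Proof.
  intros Dth t. unfold B.
  assert (C : forall s, continuous (fun s => mu * th s) s).
  { intros s. apply (continuous_scal_r (K := R_AbsRing) mu th).
    exact (ex_derive_continuous (V := R_NormedModule) th s (Dth s)). }
  apply (is_derive_comp exp (fun s => RInt (fun s => mu * th s) t0 s) t (B t) (mu * th t)).
  - apply is_derive_exp.
  - apply (is_derive_RInt (fun s => mu * th s) _ t0 t); [|apply C].
    apply filter_forall. intros b.
    apply (RInt_correct (V := R_CompleteNormedModule)).
    apply (ex_RInt_continuous (V := R_CompleteNormedModule)). intros; apply C.
Qed.

Lemma is_derive_factored_energy t :
  (forall t, ex_derive th t) ->
  (forall y : H,
     filterdiff (Phi : H -> R_NormedModule) (locally y) (fun h : H => inner (g y) h)) ->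
  is_derive x t (x' t) -> is_derive x' t (x'' t) ->
  is_derive F t
    (mu * th t * B t * (th t ^ 2 * (Phi (x t) - Phi xs) + inner (v t) (v t) / 2) +
     B t * (2 * th t * Derive th t * (Phi (x t) - Phi xs)
            + th t ^ 2 * inner (g (x t)) (x' t)
            + inner (v t) (plus (x' t)
                (plus (scal (Derive th t) (x' t) : H) (scal (th t) (x'' t) : H))))).
Proof.
  intros Dth DPhi D1 D2.
  assert (Dv : is_derive v t
                 (plus (x' t) (plus (scal (Derive th t) (x' t)) (scal (th t) (x'' t))))).
  { apply (is_derive_plus w).
    - unfold w. evar_last.
      + apply (is_derive_minus x (fun _ => xs)); [exact D1 | apply is_derive_const].
      + apply (minus_zero_r (x' t)).
    - unfold is_derive. eapply filterdiff_ext_lin.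
      + apply (filterdiff_scal_fct t th x').
        * intros; apply Rmult_comm.
        * apply Derive_correct, Dth.
        * exact D2.
      + intros h. simpl. rewrite (scal_distr_l h), !scal_assoc.
        f_equal. f_equal. apply Rmult_comm. }
  assert (DP := is_derive_comp_filterdiff _ _ x _ t (DPhi (x t)) D1).
  assert (DI := is_derive_comp_filterdiff _ _ v _ t (filterdiff_inner_self (v t)) Dv).
  assert (DB := is_derive_exp_RInt Dth t).
  assert (DT := Derive_correct _ _ (Dth t)).
  exact (is_derive_energy_form B th (fun s => Phi (x s)) (fun s => inner (v s) (v s))
           (Phi xs) _ _ _ _ t DB DT DP DI).
Qed.

Lemma continuous_factored_energy t :
  (forall t, ex_derive th t) ->
  (forall y : H,
     filterdiff (Phi : H -> R_NormedModule) (locally y) (fun h : H => inner (g y) h)) ->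
  C2_on t0 x x' x'' -> t0 <= t ->
  continuous (fun s => F (Rmax t0 s)) t.
Proof.
  intros Dth DPhi [[D1 _] [D2 _]] Ht.
  assert (C : forall (V : UniformSpace) (f : R -> V), continuous f t ->
            continuous (fun s => f (Rmax t0 s)) t).
  { intros V f Hf. apply (continuous_clamp t0 t f Ht).
    exact (filterlim_filter_le_1 _ (within_filter_lim t0 t) Hf). }
  assert (Cx := continuous_clamp t0 t x Ht (filterlim_of_filterdiff_within _ _ _ _ (D1 t Ht))).
  assert (Cx' := continuous_clamp t0 t x' Ht (filterlim_of_filterdiff_within _ _ _ _ (D2 t Ht))).
  assert (Cth := C R_UniformSpace th (ex_derive_continuous (V := R_NormedModule) th t (Dth t))).
  assert (CB := C R_UniformSpace B (ex_derive_continuous (V := R_NormedModule) B t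
                  (ex_intro _ _ (is_derive_exp_RInt Dth t)))).
  assert (CP : continuous (fun s => Phi (x (Rmax t0 s))) t).
  { apply (continuous_comp (fun s => x (Rmax t0 s)) Phi t Cx).
    apply (filterdiff_continuous (Phi : H -> R_NormedModule)). eexists. apply DPhi. }
  assert (Cv : continuous (fun s => v (Rmax t0 s)) t).
  { unfold v, w. apply (continuous_plus (V := H)).
    - apply (continuous_minus (V := H)); [exact Cx | apply continuous_const].
    - apply (continuous_scal (V := H)); [exact Cth | exact Cx']. }
  assert (CI : continuous (fun s => inner (v (Rmax t0 s)) (v (Rmax t0 s))) t).
  { apply (continuous_comp (fun s => v (Rmax t0 s)) (fun y => inner y y) t Cv).
    apply (filterdiff_continuous ((fun y : H => inner y y) : H -> R_NormedModule)). eexists.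
    apply filterdiff_inner_self. }
  unfold F.
  apply (continuous_mult (K := R_AbsRing)); [exact CB|].
  apply (continuous_plus (V := R_NormedModule)).
  - apply (continuous_mult (K := R_AbsRing)).
    + simpl. apply (continuous_mult (K := R_AbsRing)); [exact Cth|].
      apply (continuous_mult (K := R_AbsRing)); [exact Cth|]. apply continuous_const.
    + apply (continuous_minus (V := R_NormedModule)); [exact CP|apply continuous_const].
  - apply (continuous_mult (K := R_AbsRing)); [exact CI|apply continuous_const].
Qed.

End Lyapunov.

(** The Lyapunov property for any admissible [th], with the damping that [th]
    itself determines. The solution is only one-sided at [t0], so the derivative
    is used after [t0] and continuity links it to the value at [t0]. *)
Lemma energy_nonincreasing {H : HilbertSpace} (mu t0 : R) (th : R -> R)
    (Phi : H -> R) (g : H -> H) (xs : H) (x x' x'' : R -> H) :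
  0 <= mu ->
  (forall t, ex_derive th t) ->
  (forall t, t0 <= t -> 0 < th t) ->
  (forall t, t0 <= t -> 2 * Derive th t + mu * th t ^ 2 <= 1) ->
  C1_gradient Phi g -> strongly_convex mu Phi g -> argmin Phi xs ->
  solution t0 (damping mu th) g x x' x'' ->
  forall t, t0 <= t -> energy mu th t0 Phi xs x x' t <= energy mu th t0 Phi xs x x' t0.
Proof.
  intros hmu Dth Pth hth [DPhi _] SC AM [C2 ODE] t Ht.
  assert (h0 := Pth t0 (Rle_refl _)). assert (h1 := Pth t Ht).
  rewrite !energy_factored by lra.
  assert (C := fun t => continuous_factored_energy mu t0 th Phi g xs x x' x'' t Dth DPhi C2).
  destruct C2 as [[D1 _] [D2 _]].
  assert (D := fun t (Hs : t0 < t) => is_derive_factored_energy mu t0 th Phi g xs x x' x'' t Dth DPhi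
    (is_derive_of_within t0 t x _ Hs (D1 t (Rlt_le _ _ Hs)))
    (is_derive_of_within t0 t x' _ Hs (D2 t (Rlt_le _ _ Hs)))).
  refine (nonincreasing_of_derive_nonpos _ _ t0 t Ht C D _).
  clear t Ht h1 C D. intros t Ht. assert (Ht' := Rlt_le _ _ Ht).
  set (W := minus (x t) xs : H). set (V := plus W (scal (th t) (x' t))).
  assert (E : forall y, inner y (x'' t)
             = - (damping mu th t * inner y (x' t) + inner y (g (x t)))).
  { intros y. assert (Z := inner_zero_l y). rewrite inner_sym, <- (ODE t Ht') in Z.
    rewrite !inner_plus_r, inner_scal_r in Z. lra. }
  rewrite !inner_plus_r, !inner_scal_r, E.
  assert (S : Phi (x t) - Phi xs + mu / 2 * inner W W <= inner W (g (x t))).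
  { assert (S := SC (x t) xs).
    assert (Q : minus xs (x t) = opp W) by (unfold W; symmetry; apply (opp_minus (x t) xs)).
    assert (N : norm (opp W) = norm W) by apply (norm_opp W).
    rewrite Q, N, inner_opp_r, (inner_sym _ (g (x t)) W), <- inner_self in S. lra. }
  assert (P : 0 <= inner (x' t) (x' t)) by (rewrite inner_self; apply pow2_ge_0).
  assert (A := energy_derivative_nonpos mu (Phi (x t) - Phi xs) (inner (x' t) (x' t))
    (inner W W) (inner W (g (x t))) (inner (x' t) (g (x t))) (inner W (x' t))
    (th t) (Derive th t) (damping mu th t) (exp (RInt (fun s => mu * th s) t0 t))
    hmu (Pth t Ht') (Rlt_le _ _ (exp_pos _))
    (Rge_le _ _ (Rge_minus _ _ (Rle_ge _ _ (AM (x t)))))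
    P (hth t Ht') S eq_refl).
  cbv zeta in A. refine (Rle_trans _ _ _ (Req_le _ _ _) A).
  unfold V. rewrite !inner_plus_l, !inner_plus_r, !inner_scal_l, !inner_scal_r,
     (inner_sym _ (x' t) W), (inner_sym _ (g (x t)) (x' t)).
  field.
Qed.

(** * Hyperbolic functions *)

Lemma cosh_pos u : 0 < cosh u.
Proof. unfold cosh. generalize (exp_pos u) (exp_pos (- u)). lra. Qed.

Lemma cosh2_minus_sinh2 u : cosh u ^ 2 - sinh u ^ 2 = 1.
Proof.
  unfold cosh, sinh.
  assert (E : exp u * exp (- u) = 1) by (rewrite <- exp_plus, Rplus_opp_r; apply exp_0).
  nra.
Qed.

Lemma cosh_ge_1 u : 1 <= cosh u.
Proof. generalize (cosh_pos u) (cosh2_minus_sinh2 u) (pow2_ge_0 (sinh u)). nra. Qed.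

Lemma sinh_pos u : 0 < u -> 0 < sinh u.
Proof. rewrite <- sinh_0 at 2. apply sinh_lt. Qed.

Lemma tanh_pos u : 0 < u -> 0 < tanh u.
Proof. intros Hu. apply Rdiv_lt_0_compat; [now apply sinh_pos|apply cosh_pos]. Qed.

Lemma tanh_sqr_lt_1 u : tanh u ^ 2 < 1.
Proof.
  assert (C := cosh_pos u). assert (P := cosh2_minus_sinh2 u).
  replace (tanh u ^ 2) with (1 - / cosh u ^ 2).
  - assert (0 < / cosh u ^ 2) by (apply Rinv_0_lt_compat; nra). lra.
  - unfold tanh. field_simplify; [|lra|lra]. f_equal. lra.
Qed.

Lemma is_derive_tanh u : is_derive tanh u (1 - tanh u ^ 2).
Proof.
  unfold tanh. generalize (cosh_pos u); intros C.
  auto_derive; [lra|]. field. lra.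
Qed.

Lemma sinh_ge_id u : 0 <= u -> u <= sinh u.
Proof.
  intros Hu.
  destruct (MVT_gen sinh 0 u cosh) as [c [_ E]].
  - intros t _. apply is_derive_Reals, derivable_pt_lim_sinh.
  - intros t _. apply derivable_continuous_pt, derivable_pt_sinh.
  - rewrite sinh_0 in E. generalize (cosh_ge_1 c). nra.
Qed.

Lemma tanh_le_id u : 0 <= u -> tanh u <= u.
Proof.
  intros Hu.
  destruct (MVT_gen tanh 0 u (fun u => 1 - tanh u ^ 2)) as [c [_ E]].
  - intros t _. apply is_derive_tanh.
  - intros t _. apply continuity_pt_filterlim.
    exact (ex_derive_continuous (V := R_NormedModule) tanh t (ex_intro _ _ (is_derive_tanh t))).
  - replace (tanh 0) with 0 in E
      by (unfold tanh; rewrite sinh_0; field; apply Rgt_not_eq, cosh_pos).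
    generalize (pow2_ge_0 (tanh c)). nra.
Qed.

Lemma id_coth_bounds u : 0 < u -> 1 <= u * coth u <= cosh u.
Proof.
  intros Hu. assert (S := sinh_pos u Hu). assert (C := cosh_pos u).
  assert (T := tanh_le_id u (Rlt_le _ _ Hu)). assert (S' := sinh_ge_id u (Rlt_le _ _ Hu)).
  unfold tanh in T. apply (Rle_div_l (sinh u)) in T; [|easy].
  unfold coth. replace (u * (cosh u / sinh u)) with (u * cosh u / sinh u) by (field; lra).
  split.
  - apply (Rle_div_r 1); lra.
  - apply (Rle_div_l (u * cosh u)); nra.
Qed.

(** * The coefficient theta and the weight *)

Section Theta.

Context (mu kappa : R) (hmu : 0 < mu) (hkappa : 0 < kappa).

Let u t := kappa * sqrt mu * t.

Lemma scaled_time_pos t : 0 < t -> 0 < u t.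
Proof.
  intros Ht. assert (S := sqrt_lt_R0 mu hmu).
  unfold u. repeat apply Rmult_lt_0_compat; auto.
Qed.

Lemma is_derive_theta t : is_derive (theta mu kappa) t (kappa * (1 - tanh (u t) ^ 2)).
Proof.
  assert (S := sqrt_lt_R0 mu hmu). unfold theta.
  evar_last.
  - apply (is_derive_scal (fun t => tanh (kappa * sqrt mu * t))).
    apply (is_derive_comp tanh (fun t => kappa * sqrt mu * t) t).
    + apply is_derive_tanh.
    + auto_derive; reflexivity || exact I.
  - unfold scal; simpl; unfold mult; simpl. unfold u. field. lra.
Qed.

Lemma ex_derive_theta t : ex_derive (theta mu kappa) t.
Proof. eexists. apply is_derive_theta. Qed.

Lemma Derive_theta t : Derive (theta mu kappa) t = kappa * (1 - tanh (u t) ^ 2).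
Proof. apply is_derive_unique, is_derive_theta. Qed.

Lemma theta_pos t : 0 < t -> 0 < theta mu kappa t.
Proof.
  intros Ht. apply Rmult_lt_0_compat; [apply Rinv_0_lt_compat, sqrt_lt_R0, hmu|].
  now apply tanh_pos, scaled_time_pos.
Qed.

Lemma mu_theta_sqr t : mu * theta mu kappa t ^ 2 = tanh (u t) ^ 2.
Proof.
  assert (S := sqrt_lt_R0 mu hmu). rewrite <- (sqrt_sqrt mu) at 1 by lra.
  unfold theta, u. field. lra.
Qed.

Lemma continuous_theta t : continuous (theta mu kappa) t.
Proof. exact (ex_derive_continuous (V := R_NormedModule) _ t (ex_derive_theta t)). Qed.

Lemma continuous_Derive_theta t : continuous (Derive (theta mu kappa)) t.
Proof.
  apply (continuous_ext (fun t => kappa * (1 - tanh (u t) ^ 2))).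
  - intros s. now rewrite Derive_theta.
  - apply (ex_derive_continuous (V := R_NormedModule)). unfold u, tanh. auto_derive.
    apply Rgt_not_eq, cosh_pos.
Qed.

Lemma theta_nondecreasing s t : s <= t -> theta mu kappa s <= theta mu kappa t.
Proof.
  intros Hst.
  destruct (MVT_gen (theta mu kappa) s t (fun t => kappa * (1 - tanh (u t) ^ 2))) as [c [_ E]].
  - intros r _. apply is_derive_theta.
  - intros r _. apply continuity_pt_filterlim, continuous_theta.
  - assert (P := tanh_sqr_lt_1 (u c)).
    assert (Q : 0 <= kappa * (1 - tanh (u c) ^ 2)) by (apply Rmult_le_pos; lra). nra.
Qed.

(** The sum equals 2 kappa + (1 - 2 kappa) tanh^2, a convex combination of 1 and
    tanh^2. *)
Lemma theta_growth t : kappa <= 1 / 2 ->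
  0 < 2 * Derive (theta mu kappa) t + mu * theta mu kappa t ^ 2 <= 1.
Proof.
  intros Hk. rewrite Derive_theta, mu_theta_sqr.
  generalize (tanh_sqr_lt_1 (u t)) (pow2_ge_0 (tanh (u t))). nra.
Qed.

Lemma delta_theta t : 0 < t ->
  delta mu kappa t =
    sqrt mu * ((1 + kappa) * coth (u t) + (1 - kappa) * tanh (u t)).
Proof.
  intros Ht. unfold delta, damping. rewrite Derive_theta.
  assert (S := sqrt_lt_R0 mu hmu).
  assert (sinh (u t) <> 0) by now apply Rgt_not_eq, sinh_pos, scaled_time_pos.
  assert (cosh (u t) <> 0) by apply Rgt_not_eq, cosh_pos.
  rewrite <- (sqrt_sqrt mu) at 2 by lra.
  unfold theta. fold (u t). unfold coth, tanh. field. lra.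
Qed.

(** [mu * theta] has the antiderivative ln (cosh (u t)) / kappa. *)
Lemma weight_theta t0 t :
  weight mu (theta mu kappa) t0 t =
    theta mu kappa t ^ 2 * Rpower (cosh (u t) / cosh (u t0)) (/ kappa).
Proof.
  assert (S := sqrt_lt_R0 mu hmu).
  unfold weight, Rpower. do 2 f_equal.
  rewrite ln_div by apply cosh_pos.
  rewrite Rmult_minus_distr_l.
  apply is_RInt_unique.
  apply (is_RInt_derive (V := R_CompleteNormedModule) (fun t => / kappa * ln (cosh (u t)))).
  - intros s _. assert (C := cosh_pos (u s)). unfold theta, u in *.
    auto_derive; [easy|]. unfold tanh.
    assert (Q : sqrt mu * sqrt mu = mu) by (apply sqrt_sqrt; lra).
    set (m := sqrt mu) in *. clearbody m. rewrite <- Q. field. lra.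
  - intros s _. apply (continuous_scal_r (K := R_AbsRing) mu (theta mu kappa)), continuous_theta.
Qed.

End Theta.

(** * Lower bounds on the growth of the weight *)

Lemma growth_ge_sqr (u p : R) : 0 <= u -> 2 <= p ->
  u ^ 2 <= tanh u ^ 2 * Rpower (cosh u) p.
Proof.
  intros Hu Hp. assert (C := cosh_pos u). assert (S := sinh_ge_id u Hu).
  apply Rle_trans with (tanh u ^ 2 * Rpower (cosh u) 2).
  - replace (Rpower (cosh u) 2) with (cosh u ^ 2) by (symmetry; exact (Rpower_pow 2 _ C)).
    replace (tanh u ^ 2 * cosh u ^ 2) with (sinh u ^ 2) by (unfold tanh; field; lra).
    apply pow_incr. lra.
  - apply Rmult_le_compat_l; [apply pow2_ge_0|].
    apply Rle_Rpower; [apply cosh_ge_1|easy].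
Qed.

Lemma growth_ge_exp (u0 u p : R) : 0 <= u0 <= u -> 2 <= p ->
  (1 - exp (- (2 * u0))) ^ 2 * exp (p * u) / Rpower 2 p
    <= tanh u ^ 2 * Rpower (cosh u) p.
Proof.
  intros Hu Hp. assert (C := cosh_pos u).
  assert (E := exp_pos u). assert (E' := exp_pos (- u)).
  assert (EE : exp u * exp (- (2 * u)) = exp (- u)) by (rewrite <- exp_plus; f_equal; ring).
  assert (M : exp (- (2 * u)) <= exp (- (2 * u0))).
  { destruct (Req_dec u0 u) as [->|]; [lra|]. left; apply exp_increasing; lra. }
  assert (M1 : exp (- (2 * u0)) <= 1).
  { rewrite <- exp_0. destruct (Req_dec u0 0) as [->|]; [right; f_equal; lra|].
    left; apply exp_increasing; lra. }
  assert (Hs : (1 - exp (- (2 * u0))) * (exp u / 2) <= sinh u) by (unfold sinh; nra).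
  assert (Hc : exp u / 2 <= cosh u) by (unfold cosh; lra).
  (* Only the exponent [p - 2 >= 0] stays on [cosh u]; the other factor
     [cosh u ^ 2] turns [tanh u ^ 2] into [sinh u ^ 2]. *)
  assert (Split : forall a, 0 < a -> Rpower a p = a ^ 2 * Rpower a (p - 2)).
  { intros a Ha. replace p with (2 + (p - 2)) at 1 by ring. rewrite Rpower_plus. f_equal.
    exact (Rpower_pow 2 _ Ha). }
  assert (D : exp (p * u) / Rpower 2 p = Rpower (exp u / 2) p).
  { unfold Rpower. rewrite ln_div, ln_exp by lra. unfold Rdiv.
    rewrite <- exp_Ropp, <- exp_plus. f_equal. ring. }
  unfold Rdiv in D |- *. rewrite Rmult_assoc, D. fold (exp u / 2).
  rewrite (Split (exp u / 2)), (Split (cosh u)), <- !Rmult_assoc by lra.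
  apply Rmult_le_compat.
  - rewrite <- Rpow_mult_distr. apply pow2_ge_0.
  - left; apply exp_pos.
  - rewrite <- !Rpow_mult_distr. apply pow_incr. split.
    + apply Rmult_le_pos; lra.
    + replace (tanh u * cosh u) with (sinh u) by (unfold tanh; field; lra). exact Hs.
  - apply Rle_Rpower_l; lra.
Qed.

(** * Limits of the damping coefficient *)

(** Squeeze. With u = kappa sqrt nu t, the hyperbolic cotangent part of the damping is
    (1 + kappa) / (kappa t) times u coth u, which lies between 1 and cosh u, and
    the other part lies between 0 and (1 - kappa) sqrt nu u. Both bounds are
    continuous in [nu] at 0. *)
Lemma delta_vanishing_mu (kappa t : R) : 0 < kappa <= 1 -> 0 < t ->
  filterlim (fun nu => delta nu kappa t) (at_right 0) (locally ((1 + kappa) / (kappa * t))).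
Proof.
  intros Hk Ht.
  assert (Hkt : 0 < kappa * t) by nra.
  pose (lo := fun nu : R => (1 + kappa) / (kappa * t)).
  pose (hi := fun nu => (1 + kappa) / (kappa * t) * cosh (kappa * sqrt nu * t)
                 + (1 - kappa) * (sqrt nu * (kappa * sqrt nu * t))).
  assert (Chi : filterlim hi (at_right 0) (locally ((1 + kappa) / (kappa * t)))).
  { replace (locally ((1 + kappa) / (kappa * t))) with (locally (hi 0)).
    - apply (filterlim_filter_le_1 (F := locally 0)).
      + intros P HP. unfold at_right, within. now apply filter_imp with (2 := HP).
      + unfold hi.
        apply (continuous_comp sqrt (fun s => (1 + kappa) / (kappa * t) * cosh (kappa * s * t)
                 + (1 - kappa) * (s * (kappa * s * t)))); [apply continuous_sqrt|].
        apply (ex_derive_continuous (V := R_NormedModule)). auto_derive. exact I.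
    - f_equal. unfold hi. rewrite sqrt_0, Rmult_0_r, Rmult_0_l, cosh_0. ring. }
  refine (filterlim_le_le lo _ hi (Finite ((1 + kappa) / (kappa * t))) _ _ Chi);
    [|exact (filterlim_const (U := R_UniformSpace) (F := at_right 0) ((1 + kappa) / (kappa * t)))].
  exists (mkposreal 1 Rlt_0_1). intros nu _ Hnu.
  rewrite delta_theta by tauto. unfold lo, hi.
  assert (S := sqrt_lt_R0 nu Hnu). set (s := sqrt nu) in *.
  assert (Hu : 0 < kappa * s * t) by nra.
  destruct (id_coth_bounds _ Hu) as [L U].
  assert (T := tanh_le_id _ (Rlt_le _ _ Hu)). assert (T' := tanh_pos _ Hu).
  set (u := kappa * s * t) in *.
  assert (0 < (1 + kappa) / (kappa * t)) by (apply Rdiv_lt_0_compat; lra).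
  replace (s * ((1 + kappa) * coth u + (1 - kappa) * tanh u))
    with ((1 + kappa) / (kappa * t) * (u * coth u) + (1 - kappa) * (s * tanh u))
    by (unfold u; field; lra).
  assert (s * tanh u <= s * u) by nra. assert (0 <= s * tanh u) by nra.
  split; nra.
Qed.

Lemma delta_large_time (mu kappa : R) : 0 < mu -> 0 < kappa ->
  is_lim (delta mu kappa) p_infty (2 * sqrt mu).
Proof.
  intros Hmu Hk. assert (S := sqrt_lt_R0 mu Hmu).
  (* the damping in terms of z = exp (- 2 u) *)
  pose (G := fun z => sqrt mu * ((1 + kappa) * ((1 + z) / (1 - z))
                               + (1 - kappa) * ((1 - z) / (1 + z)))).
  assert (CG : continuous G 0).
  { apply (ex_derive_continuous (V := R_NormedModule)). unfold G. auto_derive. lra. }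
  assert (Lz : filterlim (fun t => exp (- (2 * (kappa * sqrt mu)) * t))
                 (Rbar_locally' p_infty) (locally 0)).
  { refine (filterlim_comp _ _ _ _ exp _ _ _ _ is_lim_exp_m).
    assert (P : 0 < 2 * (kappa * sqrt mu)) by nra.
    intros Q [M HM]. exists (- M / (2 * (kappa * sqrt mu))). intros t Ht.
    apply HM. apply (Rlt_div_l (- M)) in Ht; lra. }
  assert (E : G 0 = 2 * sqrt mu) by (unfold G; field).
  unfold is_lim. simpl Rbar_locally. rewrite <- E.
  apply (filterlim_ext_loc (fun t => G (exp (- (2 * (kappa * sqrt mu)) * t)))).
  - exists 0. intros t Ht. rewrite delta_theta by easy.
    assert (Hu := scaled_time_pos mu kappa Hmu Hk t Ht).
    unfold G.
    replace (- (2 * (kappa * sqrt mu)) * t)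
      with (- (kappa * sqrt mu * t) + - (kappa * sqrt mu * t)) by ring.
    set (u := kappa * sqrt mu * t) in *.
    assert (P := exp_pos (- u)).
    assert (P' : exp (- u) < 1) by (rewrite <- exp_0; apply exp_increasing; lra).
    assert (E1 : exp u = / exp (- u)) by (rewrite exp_Ropp, Rinv_inv; reflexivity).
    rewrite exp_plus. unfold coth, tanh, cosh, sinh. rewrite E1.
    field. repeat split; nra.
  - exact (filterlim_comp _ _ _ _ G _ _ _ Lz CG).
Qed.

(** * Decay along solutions *)

Lemma weighted_gap_bounds {H : HilbertSpace} (mu : R) (th : R -> R) (t0 : R)
    (Phi : H -> R) (xs : H) (x x' : R -> H) (t : R) :
  th t <> 0 -> argmin Phi xs ->
  0 <= weight mu th t0 t * (Phi (x t) - Phi xs) <= energy mu th t0 Phi xs x x' t.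
Proof.
  intros Ht AM. unfold energy.
  assert (A := AM (x t)). assert (S := pow2_gt_0 (th t) Ht).
  assert (W : 0 < weight mu th t0 t) by (apply Rmult_lt_0_compat; [easy|apply exp_pos]).
  split; [nra|].
  match goal with |- _ <= _ + ?r => assert (0 <= r); [|lra] end.
  apply Rmult_le_pos; [|apply pow2_ge_0].
  left. apply Rdiv_lt_0_compat; lra.
Qed.

(** The energy estimate with the closed form of the weight. It is kept free of
    divisions, so that any lower bound on the growth factor gives a rate. *)
Lemma weighted_gap_decay {H : HilbertSpace} (mu kappa t0 : R) (Phi : H -> R) (g : H -> H)
    (xs : H) (x x' x'' : R -> H) :
  0 < mu -> 0 < kappa <= 1 / 2 -> 0 < t0 ->
  C1_gradient Phi g -> strongly_convex mu Phi g -> argmin Phi xs ->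
  solution t0 (delta mu kappa) g x x' x'' ->
  forall t, t0 <= t ->
    tanh (kappa * sqrt mu * t) ^ 2 * Rpower (cosh (kappa * sqrt mu * t)) (/ kappa)
      * (Phi (x t) - Phi xs) <=
    energy mu (theta mu kappa) t0 Phi xs x x' t0 *
      (mu * Rpower (cosh (kappa * sqrt mu * t0)) (/ kappa)).
Proof.
  intros Hmu [Hk Hk2] Ht0 CG SC AM Sol t Ht.
  assert (Pt : 0 < theta mu kappa t) by (apply theta_pos; lra).
  destruct (weighted_gap_bounds mu (theta mu kappa) t0 Phi xs x x' t) as [_ L]; [lra|easy|].
  assert (E := energy_nonincreasing mu t0 (theta mu kappa) Phi g xs x x' x''
    (Rlt_le _ _ Hmu) (ex_derive_theta mu kappa Hmu)
    (fun s Hs => theta_pos mu kappa Hmu Hk s (Rlt_le_trans _ _ _ Ht0 Hs))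
    (fun s _ => proj2 (theta_growth mu kappa Hmu Hk s Hk2)) CG SC AM Sol t Ht).
  assert (LE := Rle_trans _ _ _ L E).
  rewrite weight_theta in LE by easy.
  set (u := kappa * sqrt mu * t) in *. set (u0 := kappa * sqrt mu * t0) in *.
  assert (Q : Rpower (cosh u / cosh u0) (/ kappa) * Rpower (cosh u0) (/ kappa)
            = Rpower (cosh u) (/ kappa)).
  { assert (C := cosh_pos u0). rewrite Rpower_mult_distr; [f_equal; field; lra| |easy].
    apply Rdiv_lt_0_compat; [apply cosh_pos|easy]. }
  rewrite <- Q. unfold u at 1. rewrite <- mu_theta_sqr by easy.
  set (a := theta mu kappa t) in *.
  assert (P : 0 < mu * Rpower (cosh u0) (/ kappa)) by (apply Rmult_lt_0_compat; [easy|apply exp_pos]).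
  generalize (Rmult_le_compat_r _ _ _ (Rlt_le _ _ P) LE). lra.
Qed.

Theorem theorem2p4 (mu gamma t0 : R)
    (hmu : 0 < mu) (hgamma : 3 <= gamma) (ht0 : 0 < t0) :
  let kappa := 1 / (gamma - 1) in
  let th := theta mu kappa in
  (0 < kappa <= 1 / 2) /\
  (forall t, t0 <= t -> 0 < th t) /\
  C1_on t0 th (Derive th) /\
  (forall s t, t0 <= s -> s <= t -> th s <= th t) /\
  (forall t, t0 <= t -> 0 < 2 * Derive th t + mu * th t ^ 2 <= 1) /\
  (forall t, t0 <= t ->
     delta mu kappa t =
       sqrt mu * ((1 + kappa) * coth (kappa * sqrt mu * t) +
                  (1 - kappa) * tanh (kappa * sqrt mu * t))) /\
  (forall t, 0 < t ->
     filterlim (fun nu => delta nu kappa t) (at_right 0) (locally (gamma / t))) /\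
  (forall nu, 0 < nu -> is_lim (delta nu kappa) p_infty (2 * sqrt nu)) /\
  (forall (H : HilbertSpace) (Phi : H -> R) (gradPhi : H -> H) (xs : H),
     C1_gradient Phi gradPhi ->
     strongly_convex mu Phi gradPhi ->
     argmin Phi xs ->
     forall x x' x'' : R -> H,
     solution t0 (delta mu kappa) gradPhi x x' x'' ->
     (forall t, t0 <= t ->
        Phi (x t) - Phi xs <=
          energy mu th t0 Phi xs x x' t0 *
          Rmin
            (Rpower (cosh (kappa * sqrt mu * t0)) (gamma - 1) / (kappa ^ 2 * t ^ 2))
            (Rpower 2 (gamma - 1) * mu *
               Rpower (cosh (kappa * sqrt mu * t0)) (gamma - 1) /
               (1 - exp (- (2 * kappa * sqrt mu * t0))) ^ 2 *
             exp (- (sqrt mu * t)))) /\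
     bigO_infty (fun t => Phi (x t) - Phi xs)
                (fun t => Rmin (1 / t ^ 2) (exp (- (sqrt mu * t))))).
Proof.
  intros kappa th.
  assert (Hp : 2 <= gamma - 1) by lra.
  assert (Hinv : / kappa = gamma - 1) by (unfold kappa; field; lra).
  assert (Hk : 0 < kappa <= 1 / 2).
  { unfold kappa. split; [apply Rdiv_lt_0_compat; lra|].
    apply (Rle_div_l 1); lra. }
  assert (S := sqrt_lt_R0 mu hmu).
  split; [easy|]. split; [intros t Ht; apply theta_pos; lra|].
  split.
  { apply (C1_on_of_derive (V := R_NormedModule)).
    - intros t _. apply Derive_correct, ex_derive_theta, hmu.
    - intros t _. apply continuous_Derive_theta, hmu. }
  split; [intros s t _ Hst; apply theta_nondecreasing; easy|].
  split; [intros t _; now apply theta_growth|].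
  split; [intros t Ht; apply delta_theta; lra|].
  split.
  { intros t Ht. replace (gamma / t) with ((1 + kappa) / (kappa * t))
      by (unfold kappa; field; lra).
    apply delta_vanishing_mu; lra. }
  split; [intros nu Hnu; now apply delta_large_time|].
  intros H Phi g xs CG SC AM x x' x'' Sol.
  assert (D := weighted_gap_decay mu kappa t0 Phi g xs x x' x'' hmu Hk ht0 CG SC AM Sol).
  fold th in D. set (E0 := energy mu th t0 Phi xs x x' t0) in *.
  rewrite Hinv in D.
  set (c := Rpower (cosh (kappa * sqrt mu * t0)) (gamma - 1)) in *.
  assert (Hc : 0 < c) by apply exp_pos.
  assert (HE0 : 0 <= E0).
  { destruct (weighted_gap_bounds mu th t0 Phi xs x x' t0) as [L0 L1]; [|easy|unfold E0; lra].
    apply Rgt_not_eq, theta_pos; lra. }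
  assert (Hu0 : 0 < kappa * sqrt mu * t0) by (apply scaled_time_pos; lra).
  set (d := 1 - exp (- (2 * kappa * sqrt mu * t0))).
  assert (Hd : 0 < d).
  { unfold d. assert (exp (- (2 * kappa * sqrt mu * t0)) < 1); [|lra].
    rewrite <- exp_0. apply exp_increasing. lra. }
  assert (H2 : 0 < Rpower 2 (gamma - 1)) by apply exp_pos.
  assert (B : forall t m, t0 <= t -> 0 < m ->
    m <= tanh (kappa * sqrt mu * t) ^ 2 * Rpower (cosh (kappa * sqrt mu * t)) (gamma - 1) ->
    Phi (x t) - Phi xs <= E0 * (mu * c / m)).
  { intros t m Ht Hm Hle. specialize (D t Ht). assert (A := AM (x t)).
    replace (E0 * (mu * c / m)) with (E0 * (mu * c) / m) by (field; lra).
    apply (Rle_div_r _ _ _ Hm). nra. }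
  assert (Bnd : forall t, t0 <= t -> Phi (x t) - Phi xs <=
    E0 * Rmin (c / (kappa ^ 2 * t ^ 2))
           (Rpower 2 (gamma - 1) * mu * c / d ^ 2 * exp (- (sqrt mu * t)))).
  { intros t Ht. assert (Hu : 0 < kappa * sqrt mu * t) by (apply scaled_time_pos; lra).
    rewrite Rmult_min_distr_l by easy. apply Rmin_glb.
    - replace (c / (kappa ^ 2 * t ^ 2)) with (mu * c / (kappa * sqrt mu * t) ^ 2).
      + apply B; [easy|nra|apply growth_ge_sqr; lra].
      + assert (Q : sqrt mu * sqrt mu = mu) by (apply sqrt_sqrt; lra).
        set (m := sqrt mu) in *. clearbody m. rewrite <- Q. field. lra.
    - replace (Rpower 2 (gamma - 1) * mu * c / d ^ 2 * exp (- (sqrt mu * t)))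
        with (mu * c / (d ^ 2 * exp (sqrt mu * t) / Rpower 2 (gamma - 1))).
      + apply B; [easy| |].
        * apply Rdiv_lt_0_compat; [|easy].
          apply Rmult_lt_0_compat; [apply pow_lt; easy|apply exp_pos].
        * assert (G := growth_ge_exp (kappa * sqrt mu * t0) (kappa * sqrt mu * t) (gamma - 1)).
          replace ((gamma - 1) * (kappa * sqrt mu * t)) with (sqrt mu * t) in G
            by (unfold kappa; field; lra).
          replace (2 * (kappa * sqrt mu * t0)) with (2 * kappa * sqrt mu * t0) in G by ring.
          apply G; [split; [lra|]|easy].
          apply Rmult_le_compat_l; [nra|easy].
      + rewrite exp_Ropp. field. repeat split; try lra. apply Rgt_not_eq, exp_pos. }
  split; [exact Bnd|].
  set (a := c / kappa ^ 2). set (b := Rpower 2 (gamma - 1) * mu * c / d ^ 2) in *.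
  exists (E0 * Rmax a b), t0. intros t Ht.
  assert (Ht' := Rlt_le _ _ Ht). assert (A := AM (x t)). specialize (Bnd t Ht').
  assert (M1 : 0 < 1 / t ^ 2) by (apply Rdiv_lt_0_compat; [lra|apply pow_lt; lra]).
  assert (M2 := exp_pos (- (sqrt mu * t))).
  rewrite (Rabs_pos_eq (Rmin _ _)) by (apply Rmin_glb; lra).
  rewrite Rabs_pos_eq by lra.
  refine (Rle_trans _ _ _ Bnd _). rewrite Rmult_assoc.
  apply Rmult_le_compat_l; [easy|].
  assert (Ha : 0 < a) by (apply Rdiv_lt_0_compat; [easy|apply pow_lt; lra]).
  assert (Ra := Rmax_l a b). assert (Rb := Rmax_r a b).
  rewrite Rmult_min_distr_l by lra. apply Rmin_glb.
  - refine (Rle_trans _ _ _ (Rmin_l _ _) _).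
    replace (c / (kappa ^ 2 * t ^ 2)) with (a * (1 / t ^ 2)) by (unfold a; field; lra).
    apply Rmult_le_compat_r; lra.
  - refine (Rle_trans _ _ _ (Rmin_r _ _) _). apply Rmult_le_compat_r; lra.
Qed.
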